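(* The set of real numbers $\alpha$ such that $\alpha=h_{pol}(f)$ for some homeomorphism $f$ of some compact metric space is dense in $\mathbb{R}^+=(0,\infty)$; that is, for all real numbers $0<a<b$ there exist a compact metric space $X$ and a homeomorphism $g\colon X\to X$ with polynomial entropy $h_{pol}(g)\in(a,b)$.
   Context: Polynomial entropy of a homeomorphism $f$ of a compact metric space $(X,\operatorname{dist})$: for $n\geq 1$ and $\varepsilon>0$, a set $E\subset X$ is $(n,\varepsilon)$-spanning for $f$ if for each $y\in X$ there is $x\in E$ with $\operatorname{dist}(f^k(x),f^k(y))\leq\varepsilon$ for all $0\leq k\leq n-1$. Let $r_n(\varepsilon)$ be the minimum cardinality of an $(n,\varepsilon)$-spanning set. Define $h_{pol}^{\varepsilon}(f)=\limsup_{n\to\infty}\frac{\log r_n(\varepsilon)}{\log n}$ and $h_{pol}(f)=\lim_{\varepsilon\to 0}h_{pol}^{\varepsilon}(f)\in[0,\infty]$ (the limit exists by monotonicity in $\varepsilon$). *)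

(* Defs.v *)
From HB Require Import structures.
From mathcomp Require Import all_boot all_order all_algebra.
From mathcomp Require Import all_classical all_reals all_analysis.
Set Implicit Arguments.
Unset Strict Implicit.
Unset Printing Implicit Defensive.
Import Order.TTheory GRing.Theory Num.Theory.
Import numFieldNormedType.Exports.
Local Open Scope classical_set_scope.
Local Open Scope ring_scope.

Definition homeomorphism (X Y : topologicalType) (f : X -> Y) : Prop :=
  exists g : Y -> X,
    [/\ cancel f g, cancel g f, continuous f & continuous g].

Section PolynomialEntropy.
Context {R : realType} {X : metricType R}.
Implicit Types (f : X -> X) (n : nat) (e : R).

Definition spanning f n e (E : set X) : Prop :=
  forall y, exists2 x, E x &
    forall k, (k < n)%N -> mdist (iter k f x) (iter k f y) <= e.

Definition spanning_card f n e : set nat :=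
  [set m | exists2 E : set X, spanning f n e E & (E #= `I_m)%card].

(* The minimum of [spanning_card f n e]. That set is nonempty when X is compact,
   f is continuous and 0 < e; otherwise [get] may return a default value. *)
Definition spanning_number f n e : nat :=
  get [set m | spanning_card f n e m /\
               forall m', spanning_card f n e m' -> (m <= m')%N].

Definition polent_at f e : \bar R :=
  limn_esup (fun n => (ln (spanning_number f n e)%:R / ln n%:R)%:E).

(* For a homeomorphism of a compact space, [polent_at f] is nonincreasing on
   positive reals, so this limit in [\bar R] exists. *)
Definition polent f : \bar R := lim (polent_at f e @[e --> 0^'+]).

End PolynomialEntropy.

(* Main.v *)
Require Import Defs.
From HB Require Import structures.
From mathcomp Require Import all_boot all_order all_algebra.
From mathcomp Require Import all_classical all_reals all_analysis.
From mathcomp Require Import zify ring lra.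
Set Implicit Arguments.
Unset Strict Implicit.
Unset Printing Implicit Defensive.
Import Order.TTheory GRing.Theory Num.Theory.
Import numFieldNormedType.Exports.
Local Open Scope classical_set_scope.
Local Open Scope ring_scope.

(** The twist (w, z) |-> (w, e^(iw) z) of K x S^1, with K a compact set of
frequencies, tells two frequencies at distance 1/n apart after about n
iterations, so its (n, e)-spanning numbers grow like the number of intervals
of length e/n needed to cover K: its polynomial entropy is the box dimension
of K. For K = {0} u {1/j^s : j >= 1} that dimension is 1/(s+1). The (m+1)-fold
power of this system has entropy (m+1)/(s+1), and these rationals are dense in
the positive reals. *)

(** * Bounds on spanning numbers from codes and from separated families *)

Section Counting.
Context {R : realType} {X : metricType R}.
Implicit Types (f : X -> X) (n : nat) (e : R).

(** A certificate for upper bounds: choosing one point per code gives a spanning set. A finite type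
    of codes makes powers easy to count. *)
Definition orbit_coded f n e (N : nat) : Prop :=
  exists (T : finType) (c : X -> T), #|T| = N /\
    forall x y, c x = c y ->
    forall k, (k < n)%N -> mdist (iter k f x) (iter k f y) <= e.

(** Separation by [2 * e] rather than [e] keeps one point from shadowing two members of the family
    within [e], so the family bounds spanning cardinalities directly. *)
Definition orbit_separated f n e (N : nat) : Prop :=
  exists (T : finType) (p : T -> X), #|T| = N /\
    forall s t, s != t ->
    exists2 k, (k < n)%N & 2 * e < mdist (iter k f (p s)) (iter k f (p t)).

Lemma coded_spanning_card f n e N :
  orbit_coded f n e N -> exists2 m, (m <= N)%N & spanning_card f n e m.
Proof.
move=> [T [c [<- cP]]].
have [[x0 _]|noX] := pselect (exists x : X, True); last first.
  exists 0%N => //; exists set0; last by rewrite II0; exact: card_eq00.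
  by move=> y; case: noX; exists y.
(* Codes that no point realizes are sent to [x0]; this only adds a harmless point to the spanning
   set. *)
pose h (i : 'I_#|T|) := xget x0 [set x | c x = enum_val i].
have /finite_setP[m Em] : finite_set (h @` [set: 'I_#|T|]).
  by apply: finite_image; exact: finite_finset.
exists m.
  rewrite -card_le_II -(card_le_eql Em).
  by rewrite (card_le_trans (card_image_le _ _))// (card_le_eqr card_II).
exists (h @` [set: 'I_#|T|]) => // y.
exists (h (enum_rank (c y))); first by exists (enum_rank (c y)).
apply: cP; rewrite /h enum_rankK.
by apply: (@xgetPex _ x0 [set x | c x = c y]); exists y.
Qed.

(** A code makes the set of spanning cardinalities nonempty, so the [get] in [spanning_number]
    returns a true minimum and not a default value. *)
Lemma spanning_numberP f n e N : orbit_coded f n e N ->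
  spanning_card f n e (spanning_number f n e) /\
  forall m, spanning_card f n e m -> (spanning_number f n e <= m)%N.
Proof.
move=> /coded_spanning_card[m _ hm].
apply: (@getPex _ [set m | spanning_card f n e m /\ _]).
have ex : exists m, `[< spanning_card f n e m >] by exists m; exact/asboolP.
case: (ex_minnP ex) => k /asboolP hk kmin.
by exists k; split => // m' hm'; apply: kmin; exact/asboolP.
Qed.

Lemma spanning_number_le f n e N : orbit_coded f n e N ->
  (spanning_number f n e <= N)%N.
Proof.
move=> cN; have [m mN hm] := coded_spanning_card cN.
by have [_ /(_ _ hm) h] := spanning_numberP cN; exact: leq_trans mN.
Qed.

(** By the triangle inequality, the map from separated points to spanning points that shadow them is
    injective. *)
Lemma separated_spanning_card f n e N m :
  orbit_separated f n e N -> spanning_card f n e m -> (N <= m)%N.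
Proof.
move=> [T [p [<- sep]]] [E spE Em].
have /choice[h hP] : forall i : 'I_#|T|, exists x, E x /\
    forall k, (k < n)%N ->
      mdist (iter k f x) (iter k f (p (enum_val i))) <= e.
  by move=> i; have [x Ex xP] := spE (p (enum_val i)); exists x.
have hinj : injective h.
  move=> s t hst; apply/eqP/negPn/negP => st.
  have /sep[k kn] : enum_val s != enum_val t.
    by apply: contra_neq st; exact: enum_val_inj.
  apply/negP; rewrite -leNgt.
  rewrite (le_trans (metric_triangle _ (iter k f (h s)) _))//.
  rewrite mulr_natl mulr2n lerD//.
    by rewrite metric_sym; exact: (hP s).2.
  by rewrite hst; exact: (hP t).2.
rewrite -card_le_II -(card_le_eqr Em) (card_le_eql card_II).
have := @inj_card_eq _ _ [set: 'I_#|T|] h (in2W hinj).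
rewrite card_eq_sym => /card_le_eql ->; apply: subset_card_le.
by move=> _ [i _ <-]; exact: (hP i).1.
Qed.

Lemma spanning_number_ge f n e N M : orbit_coded f n e N ->
  orbit_separated f n e M -> (M <= spanning_number f n e)%N.
Proof.
move=> cN sM; have [h _] := spanning_numberP cN.
exact: separated_spanning_card sM h.
Qed.

End Counting.

(** * From polynomial bounds to polynomial entropy *)

Section Asymptotics.
Context {R : realType}.

(** Taking logarithms, [p * ln n] and [q * ln (r n)] differ by at most [ln C]; dividing by
    [q * ln n] leaves an error that tends to 0. Integer powers on both sides avoid real
    exponents. *)
Lemma cvg_ln_ratio (r : nat -> nat) (p q C : nat) : (0 < q)%N -> (0 < C)%N ->
  (\forall n \near \oo, (n ^ p <= C * r n ^ q)%N /\ (r n ^ q <= C * n ^ p)%N) ->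
  (ln (r n)%:R / ln n%:R : R) @[n --> \oo] --> (p%:R / q%:R : R).
Proof.
move=> q0 C0 rP; apply/cvgrPdist_le => /= e e0.
(* Once [ln n] exceeds [A], the 1 makes it positive and the other term gives
   [ln C <= q * ln n * e]. *)
pose A : R := Num.max 1 (ln C%:R / (q%:R * e)).
near=> n.
have nA : expR A <= n%:R :> R by near: n; exact: nbhs_infty_ger.
have n0 : 0 < n%:R :> R by apply: lt_le_trans nA; exact: expR_gt0.
have lnA : A <= ln n%:R by rewrite -(expRK A) ler_ln// posrE// expR_gt0.
have l0 : 0 < ln (n%:R : R).
  by apply: lt_le_trans lnA; rewrite lt_max ltr01.
have [le1 le2] : (n ^ p <= C * r n ^ q)%N /\ (r n ^ q <= C * n ^ p)%N.
  by near: n.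
have CR0 : 0 < C%:R :> R by rewrite ltr0n.
have qR0 : 0 < q%:R :> R by rewrite ltr0n.
have r0 : 0 < (r n)%:R :> R.
  rewrite ltr0n lt0n; apply/eqP => rn0; move: le1.
  rewrite rn0 exp0n// muln0 leqNgt expn_gt0.
  by rewrite (_ : (0 < n)%N)//; move: n0; rewrite ltr0n.
have {}le1 : p%:R * ln n%:R <= ln C%:R + q%:R * ln (r n)%:R :> R.
  rewrite !mulr_natl -!lnXn// -lnM ?posrE ?exprn_gt0//.
  rewrite ler_ln ?posrE ?mulr_gt0 ?exprn_gt0//.
  by rewrite -!natrX -natrM ler_nat.
have {}le2 : q%:R * ln (r n)%:R <= ln C%:R + p%:R * ln n%:R :> R.
  rewrite !mulr_natl -!lnXn// -lnM ?posrE ?exprn_gt0//.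
  rewrite ler_ln ?posrE ?mulr_gt0 ?exprn_gt0//.
  by rewrite -!natrX -natrM ler_nat.
have lnC : ln C%:R <= q%:R * ln n%:R * e :> R.
  have : ln C%:R / (q%:R * e) <= ln (n%:R : R).
    by apply: le_trans lnA; rewrite le_max lexx orbT.
  by rewrite ler_pdivrMr ?mulr_gt0// mulrA [_ * q%:R]mulrC.
have -> : p%:R / q%:R - ln (r n)%:R / ln n%:R =
    (p%:R * ln n%:R - q%:R * ln (r n)%:R) / (q%:R * ln n%:R) :> R.
  by field; rewrite !gt_eqF.
rewrite normrM normfV (gtr0_norm (mulr_gt0 qR0 l0)).
rewrite ler_pdivrMr ?mulr_gt0// mulrC.
by rewrite ler_norml; lra.
Unshelve. all: by end_near. Qed.

(** The limsup is then a limit, so [polent_at f] is constant on the positive reals up to [e0]. *)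
Lemma polent_cvg_ln_ratio (X : metricType R) (f : X -> X) (l e0 : R) : 0 < e0 ->
  (forall e, 0 < e <= e0 ->
    (ln (spanning_number f n e)%:R / ln n%:R : R) @[n --> \oo] --> l) ->
  polent f = l%:E.
Proof.
move=> e0_gt0 fl; apply: cvg_lim => //.
apply: cvg_near_cst; near=> e.
have /fl : 0 < e <= e0.
  apply/andP; split; near: e; first exact: nbhs_right_gt.
  exact: nbhs_right_le.
move=> he.
have /cvg_limn_einf_sup[_ <-] : (fun n =>
    (ln (spanning_number f n e)%:R / ln n%:R)%:E) @ \oo --> l%:E.
  by apply: cvg_EFin => //; exact: nearW.
by [].
Unshelve. all: by end_near. Qed.

End Asymptotics.

(** * Subsets of a normed module as metric spaces *)

Section SetTypeMetric.
Context {R : realType} {V : normedModType R} (A : set V).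

Let dist (x y : set_type A) : R := `|val x - val y|.

Let dist_ge0 x y : 0 <= dist x y. Proof. exact: normr_ge0. Qed.

Let dist_positivity x y : dist x y = 0 -> x = y.
Proof. by move=> /normr0_eq0/subr0_eq/val_inj. Qed.

Let ballEdist x d : ball x d = [set y | dist x y < d].
Proof. by rewrite -initial_ballE -ball_normE. Qed.

HB.instance Definition _ :=
  @PseudoMetric_isMetric.Build R (set_type A) dist dist_ge0 dist_positivity
    ballEdist.

Lemma mdist_set_typeE (x y : set_type A) : mdist x y = `|val x - val y|.
Proof. by []. Qed.

End SetTypeMetric.

(** The image filter under [val] clusters at a point of [A]. The filter itself clusters there too,
    since open sets of the subtype are preimages of open sets of [T]. *)
Lemma compact_set_type (T : topologicalType) (A : set T) :
  compact A -> compact [set: set_type A].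
Proof.
move=> cA F PF _.
have [x [Ax clx]] : A `&` cluster (val @ F) !=set0.
  apply: cA; apply: nearW => z /=.
  by have := valP z; rewrite inE.
exists (SigSub (mem_set Ax)); split => // U W FU.
move=> [_ [[B oB <-] Bx] BW].
have [] := clx (val @` U) B.
- by apply: (@filterS _ F _ U) FU => z Uz; exists z.
- exact: open_nbhs_nbhs.
- by move=> _ [[z Uz <-] Bz]; exists z; split => //; exact: BW.
Qed.

(** * Finite powers of a dynamical system *)

Section RowPower.
Context {R : realType} {X : metricType R} {m : nat}.

(** The max metric has the entrywise balls of matrices, and lets orbits be compared coordinate by
    coordinate. *)
Let dist (v w : 'rV[X]_m.+1) : R :=
  \big[Num.max/0]_i mdist (v ord0 i) (w ord0 i).

Let dist_ge0 v w : 0 <= dist v w. Proof. exact: bigmax_ge_id. Qed.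

Let dist_positivity v w : dist v w = 0 -> v = w.
Proof.
move=> vw0; apply/rowP => i; apply: mdist_positivity.
by apply/eqP; rewrite eq_le mdist_ge0 andbT -vw0; exact: le_bigmax.
Qed.

Let ballEdist v d : ball v d = [set w | dist v w < d].
Proof.
apply/seteqP; split => w /=.
  move=> [d0 vw]; apply/bigmax_ltP; split => // i _.
  by have := vw ord0 i; rewrite ballEmdist.
move=> /bigmax_ltP[d0 vw]; split => // i j.
by rewrite ballEmdist/= !ord1; exact: vw.
Qed.

HB.instance Definition _ :=
  @PseudoMetric_isMetric.Build R 'rV[X]_m.+1 dist dist_ge0 dist_positivity
    ballEdist.

Lemma mdist_rowE (v w : 'rV[X]_m.+1) :
  mdist v w = \big[Num.max/0]_i mdist (v ord0 i) (w ord0 i).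
Proof. by []. Qed.

Lemma compact_row (x0 : X) : compact [set: X] -> compact [set: 'rV[X]_m.+1].
Proof.
move=> cX.
(* [rV_compact] is stated for pointed spaces; [x0] serves as the point. *)
pose P := isPointed.Build X x0.
pose Xp : ptopologicalType := HB.pack_for ptopologicalType (Metric.sort X) P.
have := @rV_compact Xp m.+1 (fun=> setT) (fun=> cX).
by congr compact; apply/seteqP; split.
Qed.

Lemma continuous_map_row (f : X -> X) :
  continuous f -> continuous (map_mx f : 'rV[X]_m.+1 -> 'rV[X]_m.+1).
Proof.
move=> cf v U [P vP PU]; exists (fun i j => f @^-1` P i j) => [i j|w wP].
  by apply: cf; have := vP i j; rewrite mxE.
by apply: PU => i j; rewrite mxE; exact: wP.
Qed.

Lemma homeomorphism_map_row (f : X -> X) :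
  homeomorphism f -> homeomorphism (map_mx f : 'rV[X]_m.+1 -> 'rV[X]_m.+1).
Proof.
move=> [g [fg gf cf cg]]; exists (map_mx g); split.
- by move=> v; apply/rowP => i; rewrite !mxE.
- by move=> v; apply/rowP => i; rewrite !mxE.
- exact: continuous_map_row.
- exact: continuous_map_row.
Qed.

Lemma iter_map_row (f : X -> X) k (v : 'rV[X]_m.+1) :
  iter k (map_mx f) v = map_mx (iter k f) v.
Proof. by elim: k => [|k IH] /=; apply/rowP => i; rewrite ?IH !mxE. Qed.

Lemma coded_row (f : X -> X) n e N : 0 <= e ->
  orbit_coded f n e N ->
  orbit_coded (map_mx f : 'rV[X]_m.+1 -> _) n e (N ^ m.+1).
Proof.
move=> e0 [T [c [<- cP]]].
exists {ffun 'I_m.+1 -> T}, (fun v : 'rV[X]_m.+1 => [ffun i => c (v ord0 i)]).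
split=> [|v w vw k kn]; first by rewrite card_ffun card_ord.
rewrite !iter_map_row mdist_rowE; apply/bigmax_leP; split => // i _.
by rewrite !mxE; apply: cP => //; move/ffunP/(_ i): vw; rewrite !ffunE.
Qed.

(** Words over the separated family are separated: two distinct words differ at some coordinate, and
    the max metric sees the separation there. *)
Lemma separated_row (f : X -> X) n e N :
  orbit_separated f n e N ->
  orbit_separated (map_mx f : 'rV[X]_m.+1 -> _) n e (N ^ m.+1).
Proof.
move=> [T [p [<- pP]]].
exists {ffun 'I_m.+1 -> T}, (fun s : {ffun 'I_m.+1 -> T} => \row_i p (s i)).
split=> [|s t st]; first by rewrite card_ffun card_ord.
have [i sti] : exists i, s i != t i.
  apply/existsP; apply: contraNT st; rewrite negb_exists => /forallP st.
  by apply/eqP/ffunP => i; apply/eqP; have := st i; rewrite negbK.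
have [k kn pk] := pP _ _ sti.
exists k => //; apply: (lt_le_trans pk); rewrite !iter_map_row mdist_rowE.
by rewrite (le_trans _ (le_bigmax _ _ i))// !mxE.
Qed.

End RowPower.

(** * Estimates for sine and cosine *)

Section TrigLipschitz.
Context {R : realType}.

Lemma lipschitz1_derive (f df : R -> R) :
  (forall x : R, is_derive x 1 f (df x)) -> (forall x, `|df x| <= 1) ->
  forall a b, `|f a - f b| <= `|a - b|.
Proof.
move=> fdf df1 a b; wlog ab : a b / a <= b.
  move=> H; have [/H//|/ltW/H h] := leP a b.
  by rewrite distrC (le_trans h)// distrC.
have [|c _ fE] := @MVT_segment R f df a b ab (fun x _ => fdf x).
  apply: derivable_within_continuous => x _.
  exact: (@ex_derive _ _ _ _ _ _ _ (fdf x)).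
by rewrite distrC fE normrM [leRHS]distrC ler_piMl.
Qed.

Lemma cos_lipschitz (a b : R) : `|cos a - cos b| <= `|a - b|.
Proof.
apply: (@lipschitz1_derive cos (fun x => - sin x)) => x.
by rewrite normrN sin_max.
Qed.

Lemma sin_lipschitz (a b : R) : `|sin a - sin b| <= `|a - b|.
Proof. by apply: (@lipschitz1_derive sin cos) => x; exact: cos_max. Qed.

Lemma cos1_lt1 : cos 1 < 1 :> R.
Proof.
have pi2 := @pi_ge2 R.
by rewrite -[ltRHS](@cos0 R) ltr_cos ?in_itv/= ?ltr01//; lra.
Qed.

(** Since [pi >= 2], the interval [1, 2] lies where cosine decreases. *)
Lemma cos_le_cos1 (x : R) : 1 <= x <= 2 -> cos x <= cos 1.
Proof.
move=> /andP[x1 x2]; have pi2 := @pi_ge2 R.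
have := x1; rewrite le_eqVlt => /predU1P[<-//|x1'].
by apply/ltW; rewrite ltr_cos ?in_itv//=; lra.
Qed.

End TrigLipschitz.

(** * The compact set of frequencies *)

Section Frequencies.
Context {R : realType} (s : nat).

Definition frequency (j : nat) : R := (j.+1%:R ^+ s)^-1.

Definition frequencies : set R := [set w | w = 0 \/ exists j, w = frequency j].

Lemma frequency_gt0 j : 0 < frequency j.
Proof. by rewrite invr_gt0 exprn_gt0. Qed.

Lemma le_frequency i j : (i <= j)%N -> frequency j <= frequency i.
Proof.
move=> ij; rewrite /frequency lef_pV2 ?posrE ?exprn_gt0//.
by rewrite lerXn2r ?nnegrE// ler_nat.
Qed.

Lemma frequencies_itv w : frequencies w -> 0 <= w <= 1.
Proof.
move=> [->|[j ->]]; first by rewrite lexx ler01.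
rewrite ltW ?frequency_gt0//=.
by apply: le_trans (le_frequency (leq0n j)) _; rewrite /frequency expr1n invr1.
Qed.

(** The nearest larger frequency is the preceding one, so consecutive indices suffice. The exponent
    [s.+1] becomes the denominator of the entropy. *)
Lemma frequency_gap i j : (0 < s)%N -> (i < j)%N ->
  (j.+1%:R ^+ s.+1)^-1 <= frequency i - frequency j.
Proof.
move=> s0 ij; case: j ij => // j; rewrite ltnS => /le_frequency ij.
apply: le_trans (lerB ij (lexx _)); rewrite lerBrDr /frequency.
move: s0; case: s => // k _.
have a0 : 0 < j.+1%:R :> R by [].
rewrite -[j.+2]addn1 natrD; move: (j.+1%:R : R) a0 => x x0.
have -> : ((x + 1) ^+ k.+2)^-1 + ((x + 1) ^+ k.+1)^-1 =
    (x + 2) / (x + 1) ^+ k.+2.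
  rewrite [in RHS]exprS [in LHS]exprS; field.
  by rewrite ?expf_neq0// gt_eqF//; lra.
have x10 : 0 < x + 1 by lra.
rewrite ler_pdivrMr ?exprn_gt0// mulrC ler_pdivlMr ?exprn_gt0//.
(* The remaining inequality (x+2) x^(k+1) <= (x+1)^(k+2) is the product of x (x+2) <= (x+1)^2 and
   x^k <= (x+1)^k. *)
rewrite [x ^+ _]exprS !(exprS (x + 1)) !mulrA.
apply: ler_pM.
- nra.
- exact/exprn_ge0/ltW.
- nra.
- by apply: lerXn2r; rewrite ?nnegrE; lra.
Qed.

(** The set is an intersection of closed sets, each an interval at 0 together with finitely many
    larger frequencies. *)
Lemma closed_frequencies : (0 < s)%N -> closed frequencies.
Proof.
move=> s0.
have -> : frequencies = \bigcap_(N in [set: nat])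
    (`[0, frequency N] `|` frequency @` `I_N).
  apply/seteqP; split => [w [->|[j ->]] N _|w wP].
  - by left; rewrite /= in_itv/= lexx ltW ?frequency_gt0.
  - have [Nj|jN] := leqP N j; last by right; exists j.
    by left; rewrite /= in_itv/= ltW ?frequency_gt0//= le_frequency.
  - have w0 : 0 <= w.
      have [|[j _ <-]] := wP 0%N I; last exact/ltW/frequency_gt0.
      by rewrite /= in_itv/= => /andP[].
    have := w0; rewrite le_eqVlt => /predU1P[<-|w_gt0]; first by left.
    (* As [s >= 1], (N+1)^s >= N+1 > 1/w, so [w] lies outside [[0, frequency N]] and must be one of
       the first [N] frequencies. *)
    right; pose N := Num.truncn w^-1.
    have [|[j _ <-]] := wP N I; last by exists j.
    rewrite /= in_itv/= => /andP[_ wN].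
    suff : frequency N < w by rewrite ltNge wN.
    rewrite invf_plt ?posrE ?exprn_gt0//.
    apply: lt_le_trans (truncnS_gt _) _.
    by apply: ler_eXnr => //; rewrite ler1n.
apply: closed_bigI => N _; apply: closedU; first exact: itv_closed.
apply: (accessible_finite_set_closed).1.
  exact/hausdorff_accessible/Rhausdorff.
exact/finite_image/finite_II.
Qed.

End Frequencies.

(** * The twist as a flow on the ambient space *)

Section TwistFlow.
Context {R : realType}.
Implicit Types (t u : R) (p : R * R * R).

(** Multiplication by e^(itw) in real coordinates. Real time makes the inverse of the twist the flow
    at time -1. *)
Definition flow t p : R * R * R :=
  (p.1.1, p.1.2 * cos (t * p.1.1) - p.2 * sin (t * p.1.1),
   p.1.2 * sin (t * p.1.1) + p.2 * cos (t * p.1.1)).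

Lemma flow0 p : flow 0 p = p.
Proof.
case: p => [[w x] y]; rewrite /flow/= mul0r cos0 sin0.
by rewrite !mulr1 !mulr0 subr0 add0r.
Qed.

Lemma flowD t u p : flow (t + u) p = flow t (flow u p).
Proof.
case: p => [[w x] y]; rewrite /flow/= mulrDl cosD sinD.
by congr (_, _, _); ring.
Qed.

Lemma continuous_flow t : continuous (flow t).
Proof.
have c1 : continuous (fun p : R * R * R => p.1.1).
  move=> p; apply: (@continuous_comp _ _ _ fst fst); exact: cvg_fst.
have c2 : continuous (fun p : R * R * R => p.1.2).
  move=> p; apply: (@continuous_comp _ _ _ fst snd);
    [exact: cvg_fst|exact: cvg_snd].
have c3 : continuous (fun p : R * R * R => p.2).
  move=> p; exact: cvg_snd.
have ct : continuous (fun p : R * R * R => t * p.1.1).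
  by move=> p; apply: cvgM; [exact: cvg_cst|exact: c1].
have cc : continuous (fun p : R * R * R => cos (t * p.1.1)).
  move=> p; apply: (@continuous_comp _ _ _ (fun p : R * R * R => t * p.1.1)).
    exact: ct.
  exact: continuous_cos.
have cs : continuous (fun p : R * R * R => sin (t * p.1.1)).
  move=> p; apply: (@continuous_comp _ _ _ (fun p : R * R * R => t * p.1.1)).
    exact: ct.
  exact: continuous_sin.
move=> p; apply: (@cvg_pair _ _ _ (nbhs p)
    (nbhs ((flow t p).1)) (nbhs (flow t p).2)).
  apply: (@cvg_pair _ _ _ (nbhs p) (nbhs p.1.1) (nbhs (flow t p).1.2)).
    exact: c1.
  apply: cvgB; apply: cvgM; [exact: c2|exact: cc|exact: c3|exact: cs].
apply: cvgD; apply: cvgM; [exact: c2|exact: cs|exact: c3|exact: cc].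
Qed.

(** Each circle coordinate is a combination of two trigonometric factors, each varying by at most
    |t| |w - w'|; this gives [2 * |t|]. The extra 1 covers the frequency coordinate. *)
Lemma flow_lipschitz t p p' : `|p.1.2| <= 1 -> `|p.2| <= 1 ->
  `|flow t p - flow t p'| <=
  (2 * `|t| + 1) * `|p.1.1 - p'.1.1| + `|p.1.2 - p'.1.2| + `|p.2 - p'.2|.
Proof.
case: p p' => [[w x] y] [[w' x'] y'] /= x1 y1.
have hc : `|cos (t * w) - cos (t * w')| <= `|t| * `|w - w'|.
  by rewrite -normrM mulrBr cos_lipschitz.
have hs : `|sin (t * w) - sin (t * w')| <= `|t| * `|w - w'|.
  by rewrite -normrM mulrBr sin_lipschitz.
have hM (a b c d B : R) : `|a| <= 1 -> `|d| <= 1 -> `|b - d| <= B ->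
    `|a * b - c * d| <= B + `|a - c|.
  move=> a1 d1 bd.
  have -> : a * b - c * d = a * (b - d) + (a - c) * d by ring.
  rewrite (le_trans (ler_normD _ _))// lerD// normrM.
    by rewrite (le_trans _ bd)// ler_piMl.
  by rewrite ler_piMr.
have h0 : 0 <= `|t| * `|w - w'| by rewrite mulr_ge0.
have h1 := normr_ge0 (w - w').
have h2 := normr_ge0 (x - x').
have h3 := normr_ge0 (y - y').
have xc := hM x (cos (t * w)) x' (cos (t * w')) _ x1 (cos_max _) hc.
have xs := hM x (sin (t * w)) x' (sin (t * w')) _ x1 (sin_max _) hs.
have yc := hM y (cos (t * w)) y' (cos (t * w')) _ y1 (cos_max _) hc.
have ys := hM y (sin (t * w)) y' (sin (t * w')) _ y1 (sin_max _) hs.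
rewrite prod_normE/= prod_normE/= !ge_max -!andbA; apply/and3P; split.
- lra.
- rewrite [X in `|X|](_ : _ = x * cos (t * w) - x' * cos (t * w') -
      (y * sin (t * w) - y' * sin (t * w'))); last by ring.
  by rewrite (le_trans (ler_normB _ _))//; lra.
- by rewrite opprD addrACA (le_trans (ler_normD _ _))//; lra.
Qed.

(** The squared chord is 2 - 2 cos(k(w - w')) >= 2 (1 - cos 1), whereas two coordinate differences
    of at most 2e would give at most 8 e^2. *)
Lemma flow_separation (k w w' e : R) : 1 <= k * (w - w') <= 2 ->
  0 <= e -> 4 * e ^+ 2 < 1 - cos 1 ->
  2 * e < `|flow k (w, 1, 0) - flow k (w', 1, 0)|.
Proof.
move=> kww' e0 he; rewrite ltNge; apply/negP.
rewrite prod_normE/= prod_normE/= !ge_max -!andbA => /and3P[_ hc hs].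
move: hc hs; rewrite /= !mul1r !mul0r !subr0 !addr0 => hc hs.
have sq (z : R) : `|z| <= 2 * e -> z ^+ 2 <= 4 * e ^+ 2.
  by rewrite -(real_normK (num_real z)) => hz; have := normr_ge0 z; nra.
have := sq _ hc; have := sq _ hs.
have := cos_le_cos1 kww'; rewrite mulrBr cosB.
have := cos2Dsin2 (k * w); have := cos2Dsin2 (k * w').
by nra.
Qed.

End TwistFlow.

(** * Half-open cells of equal width on the half-line *)

Section Cells.
Context {R : realType}.

Definition cell (d : R) (i : nat) (x : R) : Prop := i%:R * d <= x < i.+1%:R * d.

Lemma cell_dist d i x y : cell d i x -> cell d i y -> `|x - y| <= d.
Proof.
move=> /andP[x1 x2] /andP[y1 y2].
by move: x2 y2; rewrite -natr1 ler_norml => x2 y2; apply/andP; split; lra.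
Qed.

Lemma exists_cell d (N : nat) x : 0 < d -> 0 <= x < N%:R * d ->
  exists i : 'I_N, cell d i x.
Proof.
move=> d0 /andP[x0 xN].
have xd0 : 0 <= x / d by rewrite divr_ge0// ltW.
have iN : (Num.truncn (x / d) < N)%N by rewrite truncn_lt_nat// ltr_pdivrMr.
exists (Ordinal iN); rewrite /cell/=.
by have := truncn_itv xd0; rewrite ler_pdivlMr// ltr_pdivrMr.
Qed.

End Cells.

(** * The twist system and its orbit counts *)

Section TwistSpace.
Context {R : realType} (s : nat).

Definition twist_space : set (R * R * R) :=
  [set p | frequencies s p.1.1 /\ p.1.2 ^+ 2 + p.2 ^+ 2 = 1].

Lemma twist_space_le1 p : twist_space p -> `|p.1.2| <= 1 /\ `|p.2| <= 1.
Proof.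
move=> [_ h]; have := sqr_ge0 p.1.2; have := sqr_ge0 p.2.
by split; rewrite -(@expr_le1 _ 2)// real_normK ?num_real//; lra.
Qed.

Lemma flow_twist_space t p : twist_space p -> twist_space (flow t p).
Proof.
move=> [hw h]; split=> //=; have := cos2Dsin2 (t * p.1.1).
move: h; move: (p.1.2) (p.2) (cos _) (sin _) => x y c r h1 h2.
transitivity ((x ^+ 2 + y ^+ 2) * (c ^+ 2 + r ^+ 2)); first by ring.
by rewrite h1 h2 mulr1.
Qed.

Lemma compact_twist_space : (0 < s)%N -> compact twist_space.
Proof.
move=> s0.
pose box : set (R * R * R) := (@frequencies R s `*` `[-1, 1]) `*` `[-1, 1].
have cbox : compact box.
  apply: compact_setX; last exact: segment_compact.
  apply: compact_setX; last exact: segment_compact.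
  apply: (subclosed_compact (closed_frequencies s0) (@segment_compact R 0 1)).
  by move=> w /frequencies_itv; rewrite /= in_itv.
have -> : twist_space = box `&` [set p | p.1.2 ^+ 2 + p.2 ^+ 2 = 1].
  apply/seteqP; split => [p hp|p [[[hw _] _] h]] //.
  have [x1 y1] := twist_space_le1 hp.
  by case: hp => hw h; split => //; split; [split => //|];
     rewrite /= in_itv/= -ler_norml.
apply: compact_closedI => //.
have -> : [set p : R * R * R | p.1.2 ^+ 2 + p.2 ^+ 2 = 1] =
   (fun p => p.1.2 ^+ 2 + p.2 ^+ 2) @^-1` [set 1] by [].
apply: preimage_closed; last exact: closed_eq.
move=> p _; apply: cvgD.
- apply: (@continuous_comp _ _ _ (fun p : R * R * R => p.1.2)
    (fun x : R => x ^+ 2)); last exact: exprn_continuous.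
  by apply: (@continuous_comp _ _ _ fst snd); [exact: cvg_fst|exact: cvg_snd].
- apply: (@continuous_comp _ _ _ snd
    (fun x : R => x ^+ 2)); last exact: exprn_continuous.
  exact: cvg_snd.
Qed.

Definition twist_flow t (z : set_type twist_space) : set_type twist_space :=
  SigSub (mem_set (flow_twist_space t (set_valP z))).

Lemma val_twist_flow t z : val (twist_flow t z) = flow t (val z).
Proof. by []. Qed.

Lemma val_iter_twist k z : val (iter k (twist_flow 1) z) = flow k%:R (val z).
Proof.
elim: k => [|k IH]; first by rewrite flow0.
by rewrite iterS val_twist_flow IH -flowD nat1r.
Qed.

Lemma twist_flowN t : cancel (twist_flow t) (twist_flow (- t)).
Proof.
by move=> z; apply: val_inj; rewrite !val_twist_flow -flowD addNr flow0.
Qed.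

Lemma continuous_twist_flow t : continuous (twist_flow t).
Proof.
apply: continuous_comp_initial => z.
apply: (@continuous_comp _ _ _ (set_val : set_type twist_space -> _) (flow t)).
  exact: initial_continuous.
exact: continuous_flow.
Qed.

Lemma homeomorphism_twist_flow t : homeomorphism (twist_flow t).
Proof.
exists (twist_flow (- t)); split; [exact: twist_flowN| |
  exact: continuous_twist_flow|exact: continuous_twist_flow].
by rewrite -[X in cancel _ (twist_flow X)]opprK; exact: twist_flowN.
Qed.

(* A frequency up to 1 / L^s is coded by its cell of width d, of order 1 / n;
   the remaining ones are among 1 / 1^s, ..., 1 / L^s. Both families have O(L)
   members when n is at most of order L^(s+1). *)
Lemma twist_coded (e : R) : 0 < e -> exists2 C, (0 < C)%N &
  forall n L, (0 < n < (2 * L) ^ s.+1)%N ->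
    orbit_coded (twist_flow 1) n e (C * L).
Proof.
move=> e0.
pose c := (Num.truncn (4 * 2 ^+ s.+1 / e)).+1.
pose Q := (Num.truncn (2 / (e / 4))).+1.
exists ((1 + c) * Q * Q)%N; first by rewrite !muln_gt0.
move=> n L /andP[n0 nL].
have L0 : (0 < L)%N.
  by rewrite lt0n; apply: contraTneq nL => ->; rewrite muln0 exp0n.
have n0R : 0 < n%:R :> R by rewrite ltr0n.
have L0R : 0 < L%:R :> R by rewrite ltr0n.
pose d : R := e / (4 * n%:R).
have d0 : 0 < d by rewrite divr_gt0// mulr_gt0.
have e4 : 0 < e / 4 by rewrite divr_gt0.
have Qe : 2 < Q%:R * (e / 4) by rewrite -ltr_pdivrMr// truncnS_gt.
have cd : (L%:R ^+ s)^-1 < (c * L)%:R * d.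
  have ce : 4 * 2 ^+ s.+1 < c%:R * e by rewrite -ltr_pdivrMr// truncnS_gt.
  have nLR : n%:R < 2 ^+ s.+1 * L%:R ^+ s.+1 :> R.
    by rewrite -exprMn -natrM -natrX ltr_nat.
  have Lq : 0 < L%:R ^+ s.+1 :> R by rewrite exprn_gt0.
  rewrite -div1r ltr_pdivrMr ?exprn_gt0//.
  have -> : (c * L)%:R * d * L%:R ^+ s = c%:R * e * L%:R ^+ s.+1 / (4 * n%:R).
    rewrite /d natrM exprS.
    move: (c%:R : R) (L%:R ^+ s : R) (L%:R : R) (n%:R : R) n0R => a b l N N0.
    by field; rewrite gt_eqF.
  rewrite ltr_pdivlMr ?mulr_gt0// mul1r.
  rewrite (@lt_trans _ _ (4 * 2 ^+ s.+1 * L%:R ^+ s.+1))//.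
    by rewrite -mulrA ltr_pM2l.
  by rewrite ltr_pM2r.
pose T := (('I_L + 'I_(c * L)) * 'I_Q * 'I_Q)%type.
pose U (z : set_type twist_space) (t : T) :=
  [/\ match t.1.1 with
      | inl j => (val z).1.1 = frequency s j
      | inr i => cell d i (val z).1.1 end,
      cell (e / 4) t.1.2 ((val z).1.2 + 1) &
      cell (e / 4) t.2 ((val z).2 + 1)].
have /choice[code codeP] : forall z, exists t, U z t.
  move=> z; have zP := set_valP z; have [hw _] := zP.
  have [] := twist_space_le1 zP; rewrite !ler_norml.
  move=> /andP[x1 x2] /andP[y1 y2].
  have [|ix hx] := @exists_cell _ (e / 4) Q ((val z).1.2 + 1) e4.
    by apply/andP; split; lra.
  have [|iy hy] := @exists_cell _ (e / 4) Q ((val z).2 + 1) e4.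
    by apply/andP; split; lra.
  suff [k hk] : exists k : 'I_L + 'I_(c * L), match k with
      | inl j => (val z).1.1 = frequency s j
      | inr i => cell d i (val z).1.1 end by exists (k, ix, iy).
  have small : 0 <= (val z).1.1 <= (L%:R ^+ s)^-1 ->
      exists i : 'I_(c * L), cell d i (val z).1.1.
    move=> /andP[w0 wL]; apply: exists_cell => //.
    by rewrite w0 (le_lt_trans wL).
  case: hw => [w0|[j wj]].
    have [|i hi] := small; last by exists (inr i).
    by rewrite w0 lexx invr_ge0 exprn_ge0.
  have [jL|Lj] := ltnP j L; first by exists (inl (Ordinal jL)).
  have [|i hi] := small; last by exists (inr i).
  rewrite wj ltW ?frequency_gt0//=.
  by rewrite -(prednK L0) le_frequency// (leq_trans (leq_pred _)).
exists T, code; split.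
  by rewrite !card_prod card_sum !card_ord; ring.
move=> z z' zz' k kn.
have [w1 x1 y1] := codeP z; have := codeP z'; rewrite -zz' => -[w2 x2 y2].
have wd : `|(val z).1.1 - (val z').1.1| <= d.
  move: w1 w2; case: (code z).1.1 => [j -> ->|i]; last exact: cell_dist.
  by rewrite subrr normr0 ltW.
have xd := cell_dist x1 x2; have yd := cell_dist y1 y2.
rewrite mdist_set_typeE !val_iter_twist.
have [h1 h2] := twist_space_le1 (set_valP z).
apply: le_trans (flow_lipschitz _ _ h1 h2) _.
have shift (a b : R) : a + 1 - (b + 1) = a - b by ring.
rewrite normr_nat; move: xd yd; rewrite !shift => xd yd.
have : (2 * k%:R + 1) * `|(val z).1.1 - (val z').1.1| <= 2 * n%:R * d.
  apply: ler_pM => //.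
  have : k%:R + 1 <= n%:R :> R by rewrite natr1 ler_nat.
  by lra.
rewrite (_ : 2 * n%:R * d = e / 2); last by rewrite /d; field; rewrite gt_eqF.
by lra.
Qed.

Lemma twist_separated (e : R) n J : (0 < s)%N -> 0 <= e ->
  4 * e ^+ 2 < 1 - cos 1 ->
  (J ^ s.+1 < n)%N -> orbit_separated (twist_flow 1) n e J.
Proof.
move=> s0 e0 he Jn.
have pP j : twist_space (frequency s j, 1, 0).
  by split; [right; exists j|rewrite /= expr1n expr0n addr0].
pose p (j : 'I_J) : set_type twist_space := SigSub (mem_set (pP j)).
exists 'I_J, p; split=> [|i j]; first by rewrite card_ord.
wlog ij : i j / (i < j)%N.
  move=> H; rewrite neq_ltn => /orP[ij|ji].
    by apply: H => //; rewrite neq_ltn ij.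
  have [|k kn hk] := H j i ji; first by rewrite neq_ltn ji.
  by exists k; [exact: kn|rewrite metric_sym; exact: hk].
move=> _; set D : R := frequency s i - frequency s j.
have D1 : D <= 1.
  have /andP[_] : 0 <= (frequency s i : R) <= 1.
    by apply: (@frequencies_itv _ s); right; exists i.
  by have := @frequency_gt0 R s j; rewrite /D; lra.
have JD : 1 <= (J ^ s.+1)%:R * D.
  have J0 : 0 < J%:R :> R by rewrite ltr0n (leq_ltn_trans _ (ltn_ord j)).
  rewrite natrX mulrC -ler_pdivrMr ?exprn_gt0// div1r.
  apply: le_trans (frequency_gap s0 ij).
  rewrite lef_pV2 ?posrE ?exprn_gt0//.
  by apply: lerXn2r; rewrite ?nnegrE// ler_nat.
have ex : exists k, 1 <= k%:R * D by exists (J ^ s.+1)%N.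
case: (ex_minnP ex) => k kD kmin.
exists k; first exact: leq_ltn_trans (kmin _ JD) Jn.
(* k is the first time at which the angles differ by at least 1; since D <= 1,
   they then differ by at most 2. *)
rewrite mdist_set_typeE !val_iter_twist; apply: flow_separation => //.
rewrite -/D kD /=.
case: k kD kmin => [|k] kD kmin; first by move: kD; rewrite mul0r ler10.
have : k%:R * D < 1.
  by rewrite ltNge; apply/negP => /kmin; rewrite ltnn.
by rewrite -natr1; lra.
Qed.

End TwistSpace.

Lemma exists_nat_root (q n : nat) : (0 < q)%N ->
  exists L, (L ^ q <= n < L.+1 ^ q)%N.
Proof.
move=> q0; have ex : exists L, (L ^ q <= n)%N by exists 0%N; rewrite exp0n.
have bd L : (L ^ q <= n)%N -> (L <= n)%N.
  by apply: leq_trans; case: L => // L; rewrite -{1}[L.+1]expn1 leq_pexp2l.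
case: (ex_maxnP ex bd) => L Ln Lmax; exists L; rewrite Ln ltnNge.
by apply/negP => /Lmax; rewrite ltnn.
Qed.

Lemma polent_twist_row (R : realType) (s m : nat) : (0 < s)%N ->
  polent (map_mx (twist_flow 1) :
    'rV[set_type (@twist_space R s)]_m.+1 -> _) = (m.+1%:R / s.+1%:R)%:E.
Proof.
move=> s0; set g := map_mx _.
have u0 : 0 < 1 - cos 1 :> R by rewrite subr_gt0 cos1_lt1.
apply: (@polent_cvg_ln_ratio _ _ _ _ ((1 - cos 1) / 4)).
  by rewrite divr_gt0.
move=> e /andP[e_gt0 le_e].
have he : 4 * e ^+ 2 < 1 - cos 1.
  have := @cos_geN1 R 1; move: u0 le_e e_gt0.
  by move: (cos 1 : R) => c; nra.
have [C C0 codedP] := @twist_coded R s e e_gt0.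
apply: (@cvg_ln_ratio _ _ _ _ ((3 * C) ^ (s.+1 * m.+1))) => //.
  by rewrite expn_gt0 muln_gt0 C0.
near=> n.
have n2 : (2 ^ s.+1 <= n)%N by near: n; exact: nbhs_infty_ge.
have [L /andP[Ln nL]] := @exists_nat_root s.+1 n isT.
have L2 : (2 <= L)%N.
  by rewrite -ltnS -(@ltn_exp2r _ _ s.+1)// (leq_ltn_trans n2).
have cg : orbit_coded g n e ((C * L) ^ m.+1).
  apply: coded_row; first exact: ltW.
  apply: codedP; rewrite (leq_trans _ n2) ?expn_gt0//=.
  by rewrite (leq_trans nL)// leq_exp2r//; lia.
have sg : orbit_separated g n e (L.-1 ^ m.+1).
  apply: separated_row; apply: twist_separated => //; first exact: ltW.
  by rewrite (leq_trans _ Ln)// ltn_exp2r//; lia.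
have := spanning_number_le cg; have := spanning_number_ge cg sg.
set r := spanning_number _ _ _ => lo hi; split.
- have nJ : (n <= (3 * L.-1) ^ s.+1)%N.
    by rewrite (leq_trans (ltnW nL))// leq_exp2r//; lia.
  apply: (@leq_trans (((3 * L.-1) ^ s.+1) ^ m.+1)); first by rewrite leq_exp2r.
  rewrite -expnM expnMn; apply: leq_mul.
    by rewrite leq_exp2r// leq_pmulr.
  by rewrite mulnC expnM leq_exp2r.
- apply: (@leq_trans (((C * L) ^ m.+1) ^ s.+1)); first by rewrite leq_exp2r.
  rewrite -expnM [(m.+1 * _)%N]mulnC expnMn; apply: leq_mul.
    by rewrite leq_exp2r// leq_pmull.
  by rewrite expnM leq_exp2r.
Unshelve. all: by end_near. Qed.

Theorem mainTheorem6 (R : realType) (a b : R) (ha : 0 < a) (hab : a < b) :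
  exists (X : metricType R) (g : X -> X),
    [/\ compact [set: X], homeomorphism g
      & (a%:E < polent g < b%:E)%E].
Proof.
pose s := (Num.truncn (b - a)^-1).+1.
pose m := Num.truncn (s.+1%:R * a).
have sR : (b - a)^-1 < s.+1%:R.
  by rewrite (lt_trans (truncnS_gt _))// ltr_nat.
have sa : s.+1%:R * a < m.+1%:R by exact: truncnS_gt.
have ms : m%:R <= s.+1%:R * a by rewrite truncn_le// mulr_ge0// ltW.
exists 'rV[set_type (@twist_space R s)]_m.+1, (map_mx (twist_flow 1)); split.
- have p0 : @twist_space R s (0, 1, 0).
    by split; [left|rewrite /= expr1n expr0n addr0].
  pose x0 : set_type (@twist_space R s) := SigSub (mem_set p0).
  by apply: (compact_row x0); exact/compact_set_type/compact_twist_space.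
- exact/homeomorphism_map_row/homeomorphism_twist_flow.
- rewrite polent_twist_row// !lte_fin ltr_pdivlMr// ltr_pdivrMr// mulrC sa/=.
  have : 1 < s.+1%:R * (b - a) by rewrite -ltr_pdivrMr ?subr_gt0// div1r.
  by rewrite -natr1; lra.
Qed.
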